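(* The set $\mathrm{PU}$ of strict isomorphism classes of P\'olya urns, equipped with disjoint union $\sqcup$ as addition and product $\times$ as multiplication, is a commutative semiring, where (the classes of) the zero urn $\mathcal P_\emptyset$ and the unit urn $\mathcal P_0$ are the neutral elements of addition and multiplication, respectively.
   Context: A commutative semiring is a set with two commutative, associative operations $+,\cdot$ with neutral elements $0$ and $1$, such that $\cdot$ distributes over $+$ and $0\cdot x=0$ for all $x$. For a finite set $Q$, $\mathbb Z^Q$ is the free $\mathbb Z$-module on $Q$ (functions $Q\to\mathbb Z$). A map $\varphi:Q\to Q'$ induces the linear map $\hat\varphi:\mathbb Z^Q\to\mathbb Z^{Q'}$ sending the basis vector of $i$ to the basis vector of $\varphi(i)$; $\hat\varphi_*\nu$ is the push-forward of a measure $\nu$ under $\hat\varphi$. A P\'olya urn is a tuple $\mathcal U=(Q,\mu=(\mu_i)_{i\in Q},a,X(0))$, where $Q$ is a finite set (possibly empty; its elements are the colours), each $\mu_i$ is a probability measure on $\mathbb Z^Q$ (with the power set $\sigma$-algebra) supported within $\{x\in\mathbb Z^Q: x_j\ge-\delta_{ij}\ \forall j\in Q\}$, $a:Q\to\mathbb R_{\ge0}$ (activities), and $X(0):Q\to\mathbb Z_{\ge0}$ (initial configuration), such that $\mu_i=\delta_0$ (Dirac measure at $0$) whenever $a_i=0$. Urns $\mathcal U$ and $\mathcal U'=(Q',\mu',a',X'(0))$ are strictly isomorphic if there is a bijection $\varphi:Q\to Q'$ with $\mu'_{\varphi(i)}=\hat\varphi_*\mu_i$, $a'_{\varphi(i)}=a_i$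 and $X'_{\varphi(i)}(0)=X_i(0)$ for all $i\in Q$. Disjoint union. $\mathcal U\sqcup\mathcal U'$ has colour set $Q\sqcup Q'$, activity equal to $a$ on $Q$ and $a'$ on $Q'$, initial configuration equal to $X(0)$ on $Q$ and $X'(0)$ on $Q'$, and replacement measures $(\hat\iota_Q)_*\mu_i$ for $i\in Q$ and $(\hat\iota_{Q'})_*\mu'_i$ for $i\in Q'$, where $\iota_Q,\iota_{Q'}$ are the canonical injections into $Q\sqcup Q'$. Product. $\mathcal U\times\mathcal U'$ has colour set $Q\times Q'$, activities $a^\times_{(i,j)}=a_i+a'_j$, initial configuration $X^\times_{(i,j)}(0)=X_i(0)X'_j(0)$, and replacement measures $$\mu^\times_{(i,j)}=\frac{a_i}{a_i+a'_j}(\widehat{\kappa_Q})_*\mu_i+\frac{a'_j}{a_i+a'_j}(\widehat{\kappa_{Q'}})_*\mu'_j\quad\text{if }a_i+a'_j>0,$$ and $\mu^\times_{(i,j)}=\delta_0$ if $a_i+a'_j=0$, where (for the given $(i,j)$) $\kappa_Q:Q\to Q\times Q'$, $k\mapsto(k,j)$ and $\kappa_{Q'}:Q'\to Q\times Q'$, $k\mapsto(i,k)$. These operations are applied to classes in $\mathrm{PU}$ via representatives. The zero urn $\mathcal P_\emptyset$ is the unique urn with colour set $Q=\emptyset$. The unit urn $\mathcal P_0$ is the urn with a single colour $q$, $\mu_q=\delta_0$, $a_q=0$ and $X_q(0)=1$. *)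

(* Defs.v *)
From HB Require Import structures.
From mathcomp Require Import all_boot all_order all_algebra.
From mathcomp Require Import all_classical all_reals all_analysis.

Set Implicit Arguments.
Unset Strict Implicit.
Unset Printing Implicit Defensive.
Import Order.TTheory GRing.Theory Num.Theory.
Local Open Scope classical_set_scope.
Local Open Scope ring_scope.

(* Each one-sided law implies its mirror image by commutativity.
   [comPzSemiRingType] cannot be used on the type [PU] below: its carrier must
   lie in the universe of [choiceType] carriers, whereas a type of records with
   a [finType] field lives in a strictly larger one. *)
Record is_comm_semiring (T : Type) (add mul : T -> T -> T) (zero one : T) :
    Prop := IsCommSemiring {
  csr_addC : commutative add;
  csr_addA : associative add;
  csr_add0 : left_id zero add;
  csr_mulC : commutative mul;
  csr_mulA : associative mul;
  csr_mul1 : left_id one mul;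
  csr_mulDl : left_distributive mul add;
  csr_mul0 : left_zero zero mul
}.

Definition zvec (Q : finType) : Type := {ffun Q -> int}.

HB.instance Definition _ (Q : finType) := GRing.Zmodule.on (zvec Q).
HB.instance Definition _ (Q : finType) := isPointed.Build (zvec Q) 0.
HB.instance Definition _ (Q : finType) :=
  @isMeasurable.Build default_measure_display (zvec Q)
    (@discrete_measurable (zvec Q)) (@discrete_measurable0 (zvec Q))
    (@discrete_measurableC (zvec Q)) (@discrete_measurableU (zvec Q)).

Definition zbasis (Q : finType) (i : Q) : zvec Q := [ffun j => (j == i)%:R].

(* The linear extension of [zbasis i |-> zbasis (phi i)]. *)
Definition zlin (Q Q' : finType) (phi : Q -> Q') (x : zvec Q) : zvec Q' :=
  \sum_i zbasis (phi i) *~ x i.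

Lemma zlin_measurable (Q Q' : finType) (phi : Q -> Q') :
  measurable_fun [set: zvec Q] (zlin phi).
Proof. by []. Qed.

HB.instance Definition _ (Q Q' : finType) (phi : Q -> Q') :=
  isMeasurableFun.Build _ _ (zvec Q) (zvec Q') (zlin phi)
    (@zlin_measurable Q Q' phi).

Lemma zlinE (Q Q' : finType) (phi : Q -> Q') (x : zvec Q) (k : Q') :
  zlin phi x k = \sum_(i | phi i == k) x i.
Proof.
rewrite /zlin sum_ffunE [RHS]big_mkcond /=; apply: eq_bigr => i _.
rewrite ffunMzE ffunE eq_sym; case: ifP => _.
  by rewrite intz.
by rewrite mul0rz.
Qed.

Lemma zlin0 (Q Q' : finType) (phi : Q -> Q') : zlin phi 0 = 0.
Proof. by rewrite /zlin big1 // => i _; rewrite ffunE mulr0z. Qed.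

Lemma zlin_inj (Q Q' : finType) (phi : Q -> Q') (x : zvec Q) (k : Q) :
  injective phi -> zlin phi x (phi k) = x k.
Proof.
move=> phi_inj; rewrite zlinE (big_pred1 k) // => i.
by rewrite (inj_eq phi_inj).
Qed.

Lemma zlin_out (Q Q' : finType) (phi : Q -> Q') (x : zvec Q) (k : Q') :
  (forall i, phi i != k) -> zlin phi x k = 0.
Proof. by move=> phik; rewrite zlinE big_pred0 // => i; apply/negbTE. Qed.

Definition urn_support (Q : finType) (i : Q) : set (zvec Q) :=
  [set x | forall j, - (i == j)%:R <= x j].

Record urn (R : realType) := Urn {
  colour : finType;
  repl : colour -> probability (zvec colour) R;
  act : colour -> R;
  init : colour -> nat;
  act_ge0 : forall i, 0 <= act i;
  repl_support : forall i, repl i (urn_support i) = 1%E;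
  repl_act0 : forall i, act i = 0 -> forall A, repl i A = \d_(0 : zvec colour) A
}.

Arguments repl {R u} i.
Arguments act {R u} i.
Arguments init {R u} i.

Definition strict_iso (R : realType) (u v : urn R) : Prop :=
  exists phi : colour u -> colour v,
    [/\ bijective phi,
        forall i A, repl (phi i) A = distribution (repl i) (zlin phi) A,
        forall i, act (phi i) = act i
      & forall i, init (phi i) = init i].

Definition PU (R : realType) : Type :=
  {C : urn R -> Prop | exists u, C = strict_iso u}.

Definition urn_class (R : realType) (u : urn R) : PU R :=
  exist _ (strict_iso u) (ex_intro _ u erefl).

Section helpers.
Context (R : realType) (Q Q' : finType).
Implicit Types (P : probability (zvec Q) R) (phi : Q -> Q').

Lemma prob1_sub P (A B : set (zvec Q)) : P A = 1%E -> A `<=` B -> P B = 1%E.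
Proof.
move=> PA AB; apply/eqP; rewrite eq_le probability_le1 //= -PA.
by apply: le_measure => //; rewrite inE.
Qed.

Lemma zlin_support phi i (x : zvec Q) :
  injective phi -> urn_support i x -> urn_support (phi i) (zlin phi x).
Proof.
move=> phi_inj xi k.
have [/existsP[j /eqP <-]|] := boolP [exists j, phi j == k].
  by rewrite zlin_inj // (inj_eq phi_inj).
rewrite negb_exists => /forallP phik.
by rewrite zlin_out // (negbTE (phik i)) oppr0.
Qed.

Lemma distribution_support P phi i : injective phi ->
  P (urn_support i) = 1%E ->
  distribution P (zlin phi) (urn_support (phi i)) = 1%E.
Proof.
by move=> phi_inj Pi; apply: prob1_sub Pi _ => x; apply: zlin_support.
Qed.

Lemma distribution_dirac0 P phi : (forall A, P A = \d_(0 : zvec Q) A) ->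
  forall A, distribution P (zlin phi) A = \d_(0 : zvec Q') A.
Proof.
move=> P0 A; rewrite /distribution /pushforward P0 !diracE.
suff -> : (0 \in zlin phi @^-1` A) = (0 \in A) by [].
by apply/idP/idP; rewrite !inE /preimage /= zlin0.
Qed.

Lemma dirac0_support (i : Q) : \d_(0 : zvec Q) (urn_support i) = 1%E :> \bar R.
Proof.
rewrite diracE mem_set // => j.
by rewrite ffunE oppr_le0 ler0n.
Qed.

End helpers.

Section disjoint_union.
Context (R : realType) (u v : urn R).
Let Q : finType := (colour u + colour v)%type.

Definition union_repl (k : Q) : probability (zvec Q) R :=
  match k with
  | inl i => distribution (repl i) (zlin (inl : colour u -> Q))
  | inr j => distribution (repl j) (zlin (inr : colour v -> Q))
  end.

Definition union_act (k : Q) : R :=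
  match k with inl i => act i | inr j => act j end.

Definition union_init (k : Q) : nat :=
  match k with inl i => init i | inr j => init j end.

Lemma union_act_ge0 k : 0 <= union_act k.
Proof. by case: k => i; apply: act_ge0. Qed.

Lemma union_support k : union_repl k (urn_support k) = 1%E.
Proof.
by case: k => i; apply: distribution_support;
  [move=> ? ? [] | exact: repl_support | move=> ? ? [] | exact: repl_support].
Qed.

Lemma union_act0 k :
  union_act k = 0 -> forall A, union_repl k A = \d_(0 : zvec Q) A.
Proof.
by case: k => i ai; apply: distribution_dirac0; apply: repl_act0.
Qed.

Definition urn_union : urn R := Urn union_init union_act_ge0 union_support
  union_act0.

End disjoint_union.

Section product.
Context (R : realType) (u v : urn R).
Let Q : finType := (colour u * colour v)%type.

Definition prod_act (k : Q) : R := act k.1 + act k.2.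

Definition prod_init (k : Q) : nat := (init k.1 * init k.2)%N.

Definition prod_repl (k : Q) : set (zvec Q) -> \bar R :=
  let: (i, j) := k in
  fun A =>
    if 0 < act i + act j then
      ((act i / (act i + act j))%:E
         * distribution (repl i) (zlin (fun l => (l, j) : Q)) A
       + (act j / (act i + act j))%:E
         * distribution (repl j) (zlin (fun l => (i, l) : Q)) A)%E
    else \d_(0 : zvec Q) A.

Lemma prod_act_ge0 k : 0 <= prod_act k.
Proof. by apply: addr_ge0; apply: act_ge0. Qed.

Lemma prod_repl_measure k :
  exists m : {measure set (zvec Q) -> \bar R}, prod_repl k = m.
Proof.
case: k => i j; rewrite /prod_repl; have [a_gt0|_] := ltP 0 (act i + act j);
  last by exists (\d_(0 : zvec Q)).
have p_ge0 : 0 <= act i / (act i + act j).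
  by rewrite divr_ge0 ?act_ge0 // ltW.
have q_ge0 : 0 <= act j / (act i + act j).
  by rewrite divr_ge0 ?act_ge0 // ltW.
exists (measure_add
  (mscale (NngNum p_ge0) (distribution (repl i) (zlin (fun l => (l, j) : Q))))
  (mscale (NngNum q_ge0) (distribution (repl j) (zlin (fun l => (i, l) : Q))))).
apply/funext => A; symmetry.
exact: (measure_addE (mscale (NngNum p_ge0) _) (mscale (NngNum q_ge0) _)).
Qed.

Lemma prod_repl0 k : prod_repl k set0 = 0%E.
Proof. by have [m ->] := prod_repl_measure k; exact: measure0. Qed.

Lemma prod_repl_ge0 k A : (0 <= prod_repl k A)%E.
Proof. by have [m ->] := prod_repl_measure k; exact: measure_ge0. Qed.

Lemma prod_repl_sigma_additive k : semi_sigma_additive (prod_repl k).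
Proof.
by have [m ->] := prod_repl_measure k; exact: measure_semi_sigma_additive.
Qed.

HB.instance Definition _ k := isMeasure.Build _ _ _ (prod_repl k)
  (prod_repl0 k) (prod_repl_ge0 k) (@prod_repl_sigma_additive k).

Lemma prod_repl1 (i : colour u) (j : colour v) (A : set (zvec Q)) :
  distribution (repl i) (zlin (fun l => (l, j) : Q)) A = 1%E ->
  distribution (repl j) (zlin (fun l => (i, l) : Q)) A = 1%E ->
  \d_(0 : zvec Q) A = 1%E :> \bar R ->
  prod_repl (i, j) A = 1%E.
Proof.
move=> Ai Aj A0; rewrite /prod_repl; case: ifP => // a_gt0.
by rewrite Ai Aj !mule1 -EFinD -mulrDl divff // gt_eqF.
Qed.

Lemma prod_repl_setT k : prod_repl k setT = 1%E.
Proof.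
by case: k => i j; apply: prod_repl1; rewrite ?diracT //;
  exact: probability_setT.
Qed.

HB.instance Definition _ k :=
  Measure_isProbability.Build _ _ _ (prod_repl k) (prod_repl_setT k).

Lemma prod_support k : prod_repl k (urn_support k) = 1%E.
Proof.
case: k => i j; apply: prod_repl1; last exact: dirac0_support.
- apply: (@distribution_support _ _ _ _ (fun l => (l, j) : Q)).
    by move=> ? ? [].
  exact: repl_support.
- apply: (@distribution_support _ _ _ _ (fun l => (i, l) : Q)).
    by move=> ? ? [].
  exact: repl_support.
Qed.

Lemma prod_act0 k :
  prod_act k = 0 -> forall A, prod_repl k A = \d_(0 : zvec Q) A.
Proof. by case: k => i j; rewrite /prod_act /= => a0 A; rewrite a0 ltxx. Qed.

Definition urn_prod : urn R :=
  @Urn R Q (fun k => prod_repl k : probability (zvec Q) R) prod_act prod_init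
    prod_act_ge0 prod_support prod_act0.

End product.

Definition zero_urn (R : realType) : urn R :=
  @Urn R void (fun i => match i with end) (fun i => match i with end)
    (fun i => match i with end) (fun i => match i with end)
    (fun i => match i with end) (fun i => match i with end).

Definition unit_urn (R : realType) : urn R :=
  @Urn R unit (fun=> \d_(0 : zvec unit)) (fun=> 0) (fun=> 1%N)
    (fun=> lexx 0) (@dirac0_support R unit) (fun _ _ _ => erefl).

(* Main.v *)
Require Import Defs.
From mathcomp Require Import all_boot all_order all_algebra.
From mathcomp Require Import all_classical all_reals all_analysis.

(** Weighting a replacement measure by the activity of its colour gives the rate
    measure a_i mu_i, and an urn loses no information when its measures are
    replaced by these: a colour of positive activity recovers mu_i on division
    by a_i, and one of activity 0 must have mu_i = delta_0.  For rate measures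
    the case distinction and the denominators in the definition of the product
    disappear ([rate_prod]): the rate of (i, j) is the sum of the rates of i and
    of j, pushed forward to the row and to the column through (i, j).  Similarly
    the rate of a colour of a disjoint union is its rate in the summand
    ([rate_inl], [rate_inr]).

    By [strict_iso_of_rate], a bijection of colours that matches activities,
    initial configurations and rates is a strict isomorphism.  Each semiring law
    is then witnessed by the canonical bijection between finite sets, such as
    (Q * Q') * Q'' -> Q * (Q' * Q''), and the condition on rates reduces to
    associativity, commutativity and the neutral element of addition in the
    extended reals.  The same criterion shows that union and product respect
    strict isomorphism, so that they descend to classes. *)

Set Implicit Arguments.
Unset Strict Implicit.
Unset Printing Implicit Defensive.
Import Order.TTheory GRing.Theory Num.Theory.
Local Open Scope classical_set_scope.
Local Open Scope ring_scope.

(** * Functoriality of the induced linear maps *)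

Lemma zlin_id (Q : finType) (x : zvec Q) : zlin id x = x.
Proof. by apply/ffunP => k; rewrite (zlin_inj x k (@inj_id Q)). Qed.

Lemma zlin_comp (Q1 Q2 Q3 : finType) (g : Q2 -> Q3) (f : Q1 -> Q2)
    (x : zvec Q1) : zlin g (zlin f x) = zlin (g \o f) x.
Proof.
apply/ffunP => k; rewrite !zlinE.
rewrite [RHS](partition_big f (fun j => g j == k)) //=.
apply: eq_bigr => j /eqP gj; rewrite zlinE; apply: eq_bigl => i.
by case: eqP => [->|]; rewrite ?andbF // gj eqxx.
Qed.

Lemma preimage_zlin_comp (Q1 Q2 Q3 : finType) (g : Q2 -> Q3) (f : Q1 -> Q2)
    (A : set (zvec Q3)) :
  zlin f @^-1` (zlin g @^-1` A) = zlin (g \o f) @^-1` A.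
Proof. by apply/funext => x; rewrite /preimage /= zlin_comp. Qed.

Lemma preimage_zlin_id (Q : finType) (A : set (zvec Q)) :
  zlin id @^-1` A = A.
Proof. by apply/funext => x; rewrite /preimage /= zlin_id. Qed.

(** * Rate measures *)

Section rate.
Context {R : realType}.
Implicit Types u v w : urn R.

(** The push-forward of a_i mu_i under the linear map induced by [f].
    Carrying [f] along makes every later rate computation a matter of composing
    maps of colours. *)
Definition rate u (Q : finType) (f : colour u -> Q) (i : colour u)
    (A : set (zvec Q)) : \bar R :=
  ((act i)%:E * repl i (zlin f @^-1` A))%E.

(** When the common activity is 0, equality of rates says nothing, but then both
    replacement measures are the Dirac measure at 0, which linear maps
    preserve. *)
Lemma repl_of_rate u v (phi : colour u -> colour v) i A :
  act (phi i) = act i -> rate id (phi i) A = rate phi i A ->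
  repl (phi i) A = distribution (repl i) (zlin phi) A.
Proof.
rewrite /rate preimage_zlin_id => ai; rewrite ai.
have [a0 _|a_neq0] := eqVneq (act i) 0.
  by rewrite repl_act0 ?ai // distribution_dirac0 //; exact: repl_act0.
move=> /(congr1 (fun x => ((act i)^-1%:E * x)%E)).
by rewrite !muleA -EFinM mulVf // !mul1e.
Qed.

Lemma strict_iso_of_rate u v (phi : colour u -> colour v) :
  bijective phi -> (forall i, act (phi i) = act i) ->
  (forall i, init (phi i) = init i) ->
  (forall i A, rate id (phi i) A = rate phi i A) -> strict_iso u v.
Proof.
move=> phi_bij phi_act phi_init phi_rate; exists phi; split => // i A.
exact: repl_of_rate.
Qed.

Lemma rate_strict_iso u v (phi : colour u -> colour v) (Q : finType)
    (f : colour v -> Q) i A :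
  (forall i A, repl (phi i) A = distribution (repl i) (zlin phi) A) ->
  (forall i, act (phi i) = act i) ->
  rate f (phi i) A = rate (f \o phi) i A.
Proof.
move=> phi_repl phi_act.
by rewrite /rate phi_act phi_repl -preimage_zlin_comp.
Qed.

Lemma rate_inl u v (Q : finType) (f : colour (urn_union u v) -> Q)
    (i : colour u) A :
  rate f (inl i : colour (urn_union u v)) A = rate (fun l => f (inl l)) i A.
Proof.
pose inl_uv (l : colour u) : colour (urn_union u v) := inl l.
by rewrite /rate -(preimage_zlin_comp f inl_uv).
Qed.

Lemma rate_inr u v (Q : finType) (f : colour (urn_union u v) -> Q)
    (j : colour v) A :
  rate f (inr j : colour (urn_union u v)) A = rate (fun l => f (inr l)) j A.
Proof.
pose inr_uv (l : colour v) : colour (urn_union u v) := inr l.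
by rewrite /rate -(preimage_zlin_comp f inr_uv).
Qed.

(** A Leibniz rule: the factor a_i + a'_j cancels the denominators of the
    mixture, and when it vanishes so do a_i and a'_j. *)
Lemma rate_prod u v (Q : finType) (f : colour (urn_prod u v) -> Q)
    (i : colour u) (j : colour v) A :
  rate f ((i, j) : colour (urn_prod u v)) A =
  (rate (fun l => f (l, j)) i A + rate (fun l => f (i, l)) j A)%E.
Proof.
have -> : rate f ((i, j) : colour (urn_prod u v)) A =
    ((act i + act j)%:E * @prod_repl R u v (i, j) (zlin f @^-1` A))%E by [].
rewrite /rate -(preimage_zlin_comp f (fun l => (l, j))).
rewrite -(preimage_zlin_comp f (fun l => (i, l))) /prod_repl.
have ai := act_ge0 i; have aj := act_ge0 j.
case: ifPn => [a_gt0|].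
  rewrite ge0_muleDr ?mule_ge0 ?lee_fin ?divr_ge0 ?(ltW a_gt0) //.
  by rewrite !muleA -!EFinM ![(act i + act j) * _]mulrC !divfK ?gt_eqF.
rewrite lt_def addr_ge0 // andbT negbK paddr_eq0 // => /andP[/eqP -> /eqP ->].
by rewrite addr0 !mul0e adde0.
Qed.

Lemma rate_act0 u (Q : finType) (f : colour u -> Q) i A :
  act i = 0 -> rate f i A = 0%E.
Proof. by move=> a0; rewrite /rate a0 mul0e. Qed.

(** * Strict isomorphism is an equivalence relation *)

Lemma strict_iso_refl u : strict_iso u u.
Proof. by apply: (@strict_iso_of_rate _ _ id) => //; exists id. Qed.

Lemma strict_iso_sym u v : strict_iso u v -> strict_iso v u.
Proof.
case=> phi [[psi phiK psiK] phi_repl phi_act phi_init].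
apply: (@strict_iso_of_rate _ _ psi) => [|j|j|j A].
- by exists phi.
- by rewrite -phi_act psiK.
- by rewrite -phi_init psiK.
- rewrite -{2}(psiK j) (@rate_strict_iso _ _ phi) //.
  by have -> : psi \o phi = id by apply/funext.
Qed.

Lemma strict_iso_trans u v w :
  strict_iso u v -> strict_iso v w -> strict_iso u w.
Proof.
case=> phi [phi_bij phi_repl phi_act phi_init].
case=> psi [psi_bij psi_repl psi_act psi_init].
apply: (@strict_iso_of_rate _ _ (psi \o phi)) => [|i|i|i A] /=.
- exact: bij_comp.
- by rewrite psi_act phi_act.
- by rewrite psi_init phi_init.
- by rewrite (@rate_strict_iso _ _ psi) // (@rate_strict_iso _ _ phi).
Qed.

(** * Union and product respect strict isomorphism *)

Lemma strict_iso_union u u' v v' : strict_iso u u' -> strict_iso v v' ->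
  strict_iso (urn_union u v) (urn_union u' v').
Proof.
case=> phi [[phi' phiK phiK'] phi_repl phi_act phi_init].
case=> psi [[psi' psiK psiK'] psi_repl psi_act psi_init].
apply: (@strict_iso_of_rate (urn_union u v) (urn_union u' v')
  (fun k => match k with inl i => inl (phi i) | inr j => inr (psi j) end))
  => [|[i|j]|[i|j]|[i|j] A] //=.
- exists (fun k => match k with
    | inl i => inl (phi' i) | inr j => inr (psi' j) end).
    by case=> ?; rewrite ?phiK ?psiK.
  by case=> ?; rewrite ?phiK' ?psiK'.
- by rewrite !rate_inl rate_strict_iso.
- by rewrite !rate_inr rate_strict_iso.
Qed.

Lemma strict_iso_prod u u' v v' : strict_iso u u' -> strict_iso v v' ->
  strict_iso (urn_prod u v) (urn_prod u' v').
Proof.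
case=> phi [[phi' phiK phiK'] phi_repl phi_act phi_init].
case=> psi [[psi' psiK psiK'] psi_repl psi_act psi_init].
apply: (@strict_iso_of_rate (urn_prod u v) (urn_prod u' v')
  (fun k => (phi k.1, psi k.2))) => [|[i j]|[i j]|[i j] A] //=.
- exists (fun k => (phi' k.1, psi' k.2)) => -[i j] /=.
    by rewrite phiK psiK.
  by rewrite phiK' psiK'.
- by rewrite /prod_act /= phi_act psi_act.
- by rewrite /prod_init /= phi_init psi_init.
- by rewrite !rate_prod !rate_strict_iso.
Qed.

(** * The semiring laws up to strict isomorphism *)

Lemma urn_unionC u v : strict_iso (urn_union u v) (urn_union v u).
Proof.
pose swap (S T : Type) (k : S + T) : T + S :=
  match k with inl i => inr i | inr j => inl j end.
apply: (@strict_iso_of_rate (urn_union u v) (urn_union v u) (@swap _ _))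
  => [|[i|j]|[i|j]|[i|j] A] //=.
- by exists (@swap _ _) => -[].
- by rewrite rate_inl rate_inr.
- by rewrite rate_inl rate_inr.
Qed.

Lemma urn_unionA u v w :
  strict_iso (urn_union u (urn_union v w)) (urn_union (urn_union u v) w).
Proof.
apply: (@strict_iso_of_rate
  (urn_union u (urn_union v w)) (urn_union (urn_union u v) w)
  (fun k => match k with
    | inl i => inl (inl i) | inr (inl j) => inl (inr j) | inr (inr k) => inr k
    end)) => [|[i|[j|k]]|[i|[j|k]]|[i|[j|k]] A] //=.
- exists (fun k => match k with
    | inl (inl i) => inl i | inl (inr j) => inr (inl j) | inr k => inr (inr k)
    end); first by case=> [?|[?|?]].
  by case=> [[?|?]|?].
- by rewrite !rate_inl.
- by rewrite rate_inl rate_inr rate_inr rate_inl.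
- by rewrite !rate_inr.
Qed.

Lemma urn_union0 u : strict_iso (urn_union (zero_urn R) u) u.
Proof.
apply: (@strict_iso_of_rate (urn_union (zero_urn R) u) u
  (fun k => match k with inl i => match i with end | inr j => j end))
  => [|[[]|j]|[[]|j]|[[]|j] A] //=.
- by exists inr => // -[[]|].
- by rewrite rate_inr.
Qed.

Lemma urn_prodC u v : strict_iso (urn_prod u v) (urn_prod v u).
Proof.
apply: (@strict_iso_of_rate (urn_prod u v) (urn_prod v u)
  (fun k => (k.2, k.1))) => [|[i j]|[i j]|[i j] A] /=.
- by exists (fun k => (k.2, k.1)) => -[].
- exact: addrC.
- exact: mulnC.
- by rewrite !rate_prod addeC.
Qed.

Lemma urn_prodA u v w :
  strict_iso (urn_prod u (urn_prod v w)) (urn_prod (urn_prod u v) w).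
Proof.
apply: (@strict_iso_of_rate
  (urn_prod u (urn_prod v w)) (urn_prod (urn_prod u v) w)
  (fun k => ((k.1, k.2.1), k.2.2))) => [|[i [j k]]|[i [j k]]|[i [j k]] A] /=.
- by exists (fun k => (k.1.1, (k.1.2, k.2))) => [[i [j k]]|[[i j] k]].
- by rewrite /prod_act /= /prod_act addrA.
- by rewrite /prod_init /= /prod_init mulnA.
- by rewrite !rate_prod addeA.
Qed.

Lemma urn_prod1 u : strict_iso (urn_prod (unit_urn R) u) u.
Proof.
apply: (@strict_iso_of_rate (urn_prod (unit_urn R) u) u snd)
  => [|[[] j]|[[] j]|[[] j] A] /=.
- by exists (fun j => (tt, j)) => // -[[]].
- by rewrite /prod_act /= add0r.
- by rewrite /prod_init /= mul1n.
- by rewrite rate_prod (@rate_act0 (unit_urn R)) // add0e.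
Qed.

Lemma urn_prodDl u v w : strict_iso (urn_prod (urn_union u v) w)
  (urn_union (urn_prod u w) (urn_prod v w)).
Proof.
apply: (@strict_iso_of_rate (urn_prod (urn_union u v) w)
  (urn_union (urn_prod u w) (urn_prod v w))
  (fun k => match k.1 with inl i => inl (i, k.2) | inr j => inr (j, k.2) end))
  => [|[[i|j] k]|[[i|j] k]|[[i|j] k] A] //=.
- exists (fun k => match k with
    | inl (i, k) => (inl i, k) | inr (j, k) => (inr j, k) end).
    by case=> [[?|?] ?].
  by case=> [[? ?]|[? ?]].
- by rewrite rate_inl !rate_prod rate_inl.
- by rewrite rate_inr !rate_prod rate_inr.
Qed.

Lemma urn_prod0 u : strict_iso (urn_prod (zero_urn R) u) (zero_urn R).
Proof.
apply: (@strict_iso_of_rate (urn_prod (zero_urn R) u) (zero_urn R) fst)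
  => [|[[]]|[[]]|[[]]] //=.
by exists (fun i : void => match i with end) => [[[]]|[]].
Qed.

(** * Passage to classes *)

Lemma eq_urn_class u v : strict_iso u v -> urn_class u = urn_class v.
Proof.
move=> uv; apply: eq_exist; apply/funext => w; apply/propext; split.
  exact/strict_iso_trans/strict_iso_sym.
exact: strict_iso_trans.
Qed.

Lemma urn_classP (C : PU R) : exists u, C = urn_class u.
Proof. by case: C => C [u Cu]; exists u; apply: eq_exist. Qed.

Definition urn_repr (C : PU R) : urn R := projT1 (cid (urn_classP C)).

Lemma urn_reprK u : strict_iso (urn_repr (urn_class u)) u.
Proof.
rewrite /urn_repr; case: cid => v /= /(congr1 sval) /= <-.
exact: strict_iso_refl.
Qed.

Definition PU_lift (op : urn R -> urn R -> urn R) (C D : PU R) : PU R :=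
  urn_class (op (urn_repr C) (urn_repr D)).

Lemma PU_liftE (op : urn R -> urn R -> urn R) :
  (forall u u' v v', strict_iso u u' -> strict_iso v v' ->
     strict_iso (op u v) (op u' v')) ->
  forall u v, PU_lift op (urn_class u) (urn_class v) = urn_class (op u v).
Proof.
by move=> op_iso u v; apply/eq_urn_class/op_iso; exact: urn_reprK.
Qed.

End rate.

Theorem theorem7 (R : realType) :
  exists add mul : PU R -> PU R -> PU R,
    [/\ forall u v : urn R,
          add (urn_class u) (urn_class v) = urn_class (urn_union u v),
        forall u v : urn R,
          mul (urn_class u) (urn_class v) = urn_class (urn_prod u v)
      & is_comm_semiring add mul
          (urn_class (zero_urn R)) (urn_class (unit_urn R))].
Proof.
have addE := PU_liftE (@strict_iso_union R).
have mulE := PU_liftE (@strict_iso_prod R).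
exists (PU_lift (@urn_union R)), (PU_lift (@urn_prod R)); split => //.
split.
- move=> C D; have [u ->] := urn_classP C; have [v ->] := urn_classP D.
  by rewrite !addE; exact/eq_urn_class/urn_unionC.
- move=> C D E; have [u ->] := urn_classP C; have [v ->] := urn_classP D.
  have [w ->] := urn_classP E.
  by rewrite !addE; exact/eq_urn_class/urn_unionA.
- move=> C; have [u ->] := urn_classP C.
  by rewrite addE; exact/eq_urn_class/urn_union0.
- move=> C D; have [u ->] := urn_classP C; have [v ->] := urn_classP D.
  by rewrite !mulE; exact/eq_urn_class/urn_prodC.
- move=> C D E; have [u ->] := urn_classP C; have [v ->] := urn_classP D.
  have [w ->] := urn_classP E.
  by rewrite !mulE; exact/eq_urn_class/urn_prodA.
- move=> C; have [u ->] := urn_classP C.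
  by rewrite mulE; exact/eq_urn_class/urn_prod1.
- move=> C D E; have [u ->] := urn_classP C; have [v ->] := urn_classP D.
  have [w ->] := urn_classP E.
  by rewrite addE !mulE addE; exact/eq_urn_class/urn_prodDl.
- move=> C; have [u ->] := urn_classP C.
  by rewrite mulE; exact/eq_urn_class/urn_prod0.
Qed.
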